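(* Let $k$ be a commutative ring. A $\mathbb{Z}_2$-graded Lie algebra $L=L_0\oplus L_1$ over $k$ is isomorphic (as a $\mathbb{Z}_2$-graded Lie algebra) to $\mathfrak A(T)$ for some Lie triple system $T$ over $k$ if and only if $L$ is generated by $L_1$ and is $0$-centrally closed.
   Context: A Lie triple system over a commutative ring $k$ is a $k$-module $T$ with a $k$-trilinear map $[\ ,\ ,\ ]:T\times T\times T\to T$ such that for all $a,b,c,d,e\in T$: $[a,a,b]=0$; $[a,b,c]+[b,c,a]+[c,a,b]=0$; $[a,b,[c,d,e]]=[[a,b,c],d,e]+[c,[a,b,d],e]+[c,d,[a,b,e]]$. A $\mathbb{Z}_2$-graded Lie algebra is a Lie algebra $L=L_0\oplus L_1$ (direct sum of $k$-submodules) with $[L_i,L_j]\subseteq L_{i+j}$ for $i,j\in\mathbb Z_2$; a homomorphism $\varphi:L\to K$ is graded if $\varphi(L_i)\subseteq K_i$. A central $0$-extension of $L$ is a surjective graded homomorphism $\varphi:K\to L$ of $\mathbb{Z}_2$-graded Lie algebras with $\ker\varphi\subseteq K_0\cap\mathrm{Center}(K)$; it splits if there is a graded homomorphism $\psi:L\to K$ with $\varphi\circ\psi=\mathrm{id}_L$. $L$ is $0$-centrally closed if every central $0$-extension of $L$ splits. Construction of $\mathfrak A(T)$: for $a,b\in T$ let $D_{a,b}\in\mathrm{End}_k(T)$, $D_{a,b}c=[a,b,c]$. Let $D_{a,b}$ act on the exterior square $T\wedge T$ over $k$ by $D_{a,b}\cdot(c\wedge d)=D_{a,b}c\wedge d+c\wedge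 D_{a,b}d$. Let $\lambda:T\wedge T\to\mathrm{End}_k(T)$ be the linear map with $\lambda(a\wedge b)=D_{a,b}$, let $A(T\wedge T)=\mathrm{span}_k\{\lambda(x)\cdot x:x\in T\wedge T\}$, let $\langle T,T\rangle=(T\wedge T)/A(T\wedge T)$ and let $\langle a,b\rangle$ be the coset of $a\wedge b$. Then $\langle T,T\rangle$ is a Lie algebra under $[\langle a,b\rangle,\langle c,d\rangle]=\langle D_{a,b}c,d\rangle+\langle c,D_{a,b}d\rangle$, and $\mu(\langle a,b\rangle)=D_{a,b}$ defines a Lie algebra homomorphism $\mu:\langle T,T\rangle\to\mathrm{End}_k(T)$. The Lie algebra $\mathfrak A(T)$ is the $k$-module $\langle T,T\rangle\oplus T$ with product $[X+a,Y+b]=([X,Y]+\langle a,b\rangle)+(\mu(X)b-\mu(Y)a)$; it is $\mathbb{Z}_2$-graded with $\mathfrak A(T)_0=\langle T,T\rangle$ and $\mathfrak A(T)_1=T$. *)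

(* Defs.v *)
From HB Require Import structures.
From mathcomp Require Import all_boot all_algebra.
From mathcomp Require Import finmap boolp classical_sets functions.
From mathcomp.multinomials Require Import monalg.

Set Implicit Arguments.
Unset Strict Implicit.
Unset Printing Implicit Defensive.

Import GRing.Theory.
Local Open Scope ring_scope.
Local Open Scope classical_set_scope.
Local Open Scope quotient_scope.

HB.mixin Record isLieTriple (k : comPzRingType) T of GRing.Lmodule k T := {
  triple : T -> T -> T -> T;
  triple_linear1 : forall b c, linear (fun a => triple a b c);
  triple_linear2 : forall a c, linear (fun b => triple a b c);
  triple_linear3 : forall a b, linear (fun c => triple a b c);
  triple_alt : forall a b, triple a a b = 0;
  triple_cyc : forall a b c, triple a b c + triple b c a + triple c a b = 0;
  triple_der : forall a b c d e,
    triple a b (triple c d e) =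
      triple (triple a b c) d e + triple c (triple a b d) e
      + triple c d (triple a b e)
}.

#[short(type="lieTripleType")]
HB.structure Definition LieTriple (k : comPzRingType) :=
  {T of isLieTriple k T & GRing.Lmodule k T}.

HB.mixin Record isLieAlgebra (k : comPzRingType) L of GRing.Lmodule k L := {
  lie : L -> L -> L;
  lie_linearl : forall y, linear (fun x => lie x y);
  lie_linearr : forall x, linear (fun y => lie x y);
  liexx : forall x, lie x x = 0;
  lie_jacobi : forall x y z,
    lie x (lie y z) + lie y (lie z x) + lie z (lie x y) = 0
}.

#[short(type="lieAlgType")]
HB.structure Definition LieAlgebra (k : comPzRingType) :=
  {L of isLieAlgebra k L & GRing.Lmodule k L}.

HB.mixin Record isZ2Graded (k : comPzRingType) L of LieAlgebra k L := {
  grade : 'Z_2 -> {pred L};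
  grade_submod : forall i, submod_closed (grade i);
  grade_span : forall x,
    exists2 x0, x0 \in grade 0 & exists2 x1, x1 \in grade 1 & x = x0 + x1;
  grade_indep : forall x, x \in grade 0 -> x \in grade 1 -> x = 0;
  grade_lie : forall i j x y,
    x \in grade i -> y \in grade j -> lie x y \in grade (i + j)
}.

#[short(type="gradedLieAlgType")]
HB.structure Definition GradedLieAlgebra (k : comPzRingType) :=
  {L of isZ2Graded k L & LieAlgebra k L}.

Section GradedLieAlgebraNotions.
Variable k : comPzRingType.
Implicit Types K L : gradedLieAlgType k.

Definition graded_hom K L (f : K -> L) : Prop :=
  [/\ linear f,
      forall x y, f (lie x y) = lie (f x) (f y)
    & forall i x, x \in grade i -> f x \in grade i].

Definition graded_iso K L : Prop :=
  exists (f : K -> L) (g : L -> K),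
    [/\ graded_hom f, graded_hom g, cancel f g & cancel g f].

Definition lie_center L : set L := [set x | forall y, lie x y = 0].

Definition central_0_extension K L (phi : K -> L) : Prop :=
  [/\ graded_hom phi,
      (forall y, exists x, phi x = y)
    & forall x, phi x = 0 -> x \in grade 0 /\ lie_center x].

Definition extension_splits K L (phi : K -> L) : Prop :=
  exists2 psi : L -> K, graded_hom psi & cancel psi phi.

Definition zero_centrally_closed L : Prop :=
  forall K (phi : K -> L), central_0_extension phi -> extension_splits phi.

Definition lie_subalg_closed L (S : {pred L}) : Prop :=
  submod_closed S /\ {in S &, forall x y, lie x y \in S}.

Definition generated_by_odd L : Prop :=
  forall S : {pred L}, lie_subalg_closed S -> {subset grade 1 <= S} ->
  forall x, x \in S.

End GradedLieAlgebraNotions.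

Section SpanQuotient.
Variables (k : pzRingType) (V : lmodType k) (G : set V).

Definition span : {pred V} := fun x =>
  `[< forall S : {pred V}, submod_closed S -> (forall y, G y -> y \in S) ->
      x \in S >].

Lemma spanP x :
  reflect (forall S : {pred V}, submod_closed S ->
             (forall y, G y -> y \in S) -> x \in S)
          (x \in span).
Proof. exact: asboolP. Qed.

Lemma span_submod : submod_closed span.
Proof.
split=> [|c x y /spanP Sx /spanP Sy]; apply/spanP=> S Ssub GS.
  exact: Ssub.1.
exact: Ssub.2 (Sx S Ssub GS) (Sy S Ssub GS).
Qed.

HB.instance Definition _ := GRing.isSubmodClosed.Build k V span span_submod.

Lemma mem_span x : G x -> x \in span.
Proof. by move=> Gx; apply/spanP=> S _ /(_ _ Gx). Qed.

Lemma span_ind (P : V -> Prop) :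
  P 0 -> (forall c x y, P x -> P y -> P (c *: x + y)) ->
  (forall x, G x -> P x) -> forall x, x \in span -> P x.
Proof.
move=> P0 Plin PG x /spanP/(_ (fun x => `[< P x >])) Px.
apply/asboolP; apply: Px => [|y Gy]; last by apply/asboolP/PG.
split; first exact/asboolP.
by move=> c y z /asboolP Py /asboolP Pz; apply/asboolP/Plin.
Qed.

Definition quot_span := Quotient.quot span.

HB.instance Definition _ := Choice.on quot_span.

End SpanQuotient.

(* The operations are locked to keep unification from unfolding them. *)

HB.lock Definition quot_class (k : pzRingType) (V : lmodType k) (G : set V)
  (x : V) : quot_span G := \pi x.
HB.lock Definition quot_repr (k : pzRingType) (V : lmodType k) (G : set V)
  (x : quot_span G) : V := repr x.

HB.lock Definition quot_zero (k : pzRingType) (V : lmodType k) (G : set V) :=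
  quot_class G 0.
HB.lock Definition quot_opp (k : pzRingType) (V : lmodType k) (G : set V)
  (x : quot_span G) := quot_class G (- quot_repr x).
HB.lock Definition quot_add (k : pzRingType) (V : lmodType k) (G : set V)
  (x y : quot_span G) := quot_class G (quot_repr x + quot_repr y).
HB.lock Definition quot_scale (k : pzRingType) (V : lmodType k) (G : set V)
  (c : k) (x : quot_span G) := quot_class G (c *: quot_repr x).

Section SpanQuotientModule.
Variables (k : pzRingType) (V : lmodType k) (G : set V).
Local Notation class := (quot_class G).

Lemma quot_reprK x : class (quot_repr x) = x.
Proof. by rewrite [quot_class]unlock [quot_repr]unlock reprK. Qed.

Lemma quot_class_eq x y : class x = class y <-> x - y \in span G.
Proof.
rewrite [quot_class]unlock (Quotient.idealrBE (span G)).
exact: (rwP eqP).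
Qed.

Lemma quot_oppE x : quot_opp (class x) = class (- x).
Proof.
rewrite [quot_opp]unlock; apply/quot_class_eq; rewrite -opprD rpredN.
by apply/quot_class_eq; rewrite quot_reprK.
Qed.

Lemma quot_addE x y : quot_add (class x) (class y) = class (x + y).
Proof.
rewrite [quot_add]unlock; apply/quot_class_eq; rewrite opprD addrACA rpredD //;
  by apply/quot_class_eq; rewrite quot_reprK.
Qed.

Lemma quot_scaleE c x : quot_scale c (class x) = class (c *: x).
Proof.
rewrite [quot_scale]unlock; apply/quot_class_eq; rewrite -scalerBr rpredZ //.
by apply/quot_class_eq; rewrite quot_reprK.
Qed.

Let quotE := (quot_oppE, quot_addE, quot_scaleE).

Fact quot_addA : associative (@quot_add k V G).
Proof.
move=> x y z; rewrite -[x]quot_reprK -[y]quot_reprK -[z]quot_reprK.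
by rewrite !quotE addrA.
Qed.
Fact quot_addC : commutative (@quot_add k V G).
Proof.
by move=> x y; rewrite -[x]quot_reprK -[y]quot_reprK !quotE addrC.
Qed.
Fact quot_add0 : left_id (quot_zero G) (@quot_add k V G).
Proof.
by move=> x; rewrite [quot_zero]unlock -[x]quot_reprK !quotE add0r.
Qed.
Fact quot_addN : left_inverse (quot_zero G) (@quot_opp k V G) (@quot_add k V G).
Proof.
by move=> x; rewrite [quot_zero]unlock -[x]quot_reprK !quotE addNr.
Qed.

HB.instance Definition _ := GRing.isZmodule.Build (quot_span G)
  quot_addA quot_addC quot_add0 quot_addN.

Lemma quot_classD x y : class (x + y) = class x + class y.
Proof. exact/esym/quot_addE. Qed.

Fact quot_scaleA a b (x : quot_span G) :
  quot_scale a (quot_scale b x) = quot_scale (a * b) x.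
Proof. by rewrite -[x]quot_reprK !quotE scalerA. Qed.
Fact quot_scale1 : left_id 1 (@quot_scale k V G).
Proof. by move=> x; rewrite -[x]quot_reprK !quotE scale1r. Qed.
Fact quot_scaleDr : right_distributive (@quot_scale k V G) +%R.
Proof.
move=> c x y; rewrite -[x]quot_reprK -[y]quot_reprK.
by rewrite -quot_classD !quotE scalerDr quot_classD.
Qed.
Fact quot_scaleDl (x : quot_span G) :
  {morph (@quot_scale k V G)^~ x : a b / a + b}.
Proof.
by move=> a b; rewrite -[x]quot_reprK !quotE scalerDl quot_classD.
Qed.

HB.instance Definition _ := GRing.Zmodule_isLmodule.Build k (quot_span G)
  quot_scaleA quot_scale1 quot_scaleDr quot_scaleDl.

Lemma quot_class_linear : linear class.
Proof. by move=> c x y; rewrite quot_classD -quot_scaleE. Qed.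
HB.instance Definition _ :=
  GRing.isLinear.Build k V (quot_span G) _ class quot_class_linear.

End SpanQuotientModule.

(* Free modules. [malg] already carries this module structure, but only over *)
(* nonzero rings, while here the base ring may be zero.                      *)

Definition free_mod (k : pzRingType) (X : choiceType) : Type := {malg k[X]}.

Section FreeModule.
Variables (k : pzRingType) (X : choiceType).

HB.instance Definition _ := GRing.Zmodule.on (free_mod k X).

Definition free_scale (c : k) (g : free_mod k X) : free_mod k X :=
  \sum_(x <- msupp g) mkmalgU x (c * mcoeff x g).

Lemma free_scaleE c g x : mcoeff x (free_scale c g) = c * mcoeff x g.
Proof.
rewrite [in RHS](monalgE g) /free_scale !raddf_sum mulr_sumr.
by apply: eq_bigr => y _ /=; rewrite !mcoeffU mulrnAr.
Qed.

Fact free_scaleA a b g : free_scale a (free_scale b g) = free_scale (a * b) g.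
Proof. by apply/malgP=> x; rewrite !free_scaleE mulrA. Qed.
Fact free_scale1 : left_id 1 free_scale.
Proof. by move=> g; apply/malgP=> x; rewrite !free_scaleE mul1r. Qed.
Fact free_scaleDr : right_distributive free_scale +%R.
Proof.
by move=> c g h; apply/malgP=> x; rewrite !(free_scaleE, mcoeffD) mulrDr.
Qed.
Fact free_scaleDl g : {morph free_scale^~ g : a b / a + b}.
Proof.
by move=> a b; apply/malgP=> x; rewrite !(free_scaleE, mcoeffD) mulrDl.
Qed.

HB.instance Definition _ := GRing.Zmodule_isLmodule.Build k (free_mod k X)
  free_scaleA free_scale1 free_scaleDr free_scaleDl.

Definition free_gen (x : X) : free_mod k X := mkmalgU x 1.

Definition free_lift (V : lmodType k) (f : X -> V) (g : free_mod k X) : V :=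
  \sum_(x <- msupp g) mcoeff x g *: f x.

Lemma free_liftEw (V : lmodType k) (f : X -> V) (g : free_mod k X)
    (A : {fset X}) : (msupp g `<=` A)%fset ->
  free_lift f g = \sum_(x <- A) mcoeff x g *: f x.
Proof.
move=> gA; rewrite /free_lift; apply: big_fset_incl => // x _.
by rewrite -mcoeff_eq0 => /eqP ->; rewrite scale0r.
Qed.

Lemma free_lift_linear (V : lmodType k) (f : X -> V) : linear (free_lift f).
Proof.
move=> c g h.
pose A := (msupp g `|` msupp h `|` msupp (c *: g + h : free_mod k X))%fset.
have gA : (msupp g `<=` A)%fset.
  by apply/fsubsetP=> x xg; rewrite !in_fsetU xg.
have hA : (msupp h `<=` A)%fset.
  by apply/fsubsetP=> x xh; rewrite !in_fsetU xh orbT.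
have ghA : (msupp (c *: g + h : free_mod k X) `<=` A)%fset.
  by apply/fsubsetP=> x xgh; rewrite !in_fsetU xgh orbT.
rewrite (free_liftEw _ gA) (free_liftEw _ hA) (free_liftEw _ ghA).
rewrite scaler_sumr -big_split; apply: eq_bigr => x _ /=.
by rewrite mcoeffD free_scaleE scalerDl scalerA.
Qed.

Lemma free_lift_gen (V : lmodType k) (f : X -> V) x :
  free_lift f (free_gen x) = f x.
Proof.
rewrite (@free_liftEw _ _ _ [fset x]%fset) ?msuppU_le //.
by rewrite big_seq_fset1 mcoeffUU scale1r.
Qed.

Lemma free_gen_ind (P : free_mod k X -> Prop) :
  P 0 -> (forall c g h, P g -> P h -> P (c *: g + h)) ->
  (forall x, P (free_gen x)) -> forall g, P g.
Proof.
move=> P0 Plin Pgen g; rewrite (monalgE g); elim/big_ind: _ => // [a b Pa Pb|x _].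
  by have := Plin 1 a b Pa Pb; rewrite scale1r.
have -> : mkmalgU x (mcoeff x g) = mcoeff x g *: free_gen x + 0 :> free_mod k X.
  by apply/malgP=> y; rewrite addr0 free_scaleE !mcoeffU mulrnAr mulr1.
exact: Plin.
Qed.

End FreeModule.

Section ExteriorSquare.
Variables (k : comPzRingType) (T : lmodType k).

Let gen (a b : T) : free_mod k (T * T)%type := free_gen k (a, b).

Definition ext_relators : set (free_mod k (T * T)%type) :=
  [set g | (exists c a a' b, g = gen (c *: a + a') b - (c *: gen a b + gen a' b))
        \/ (exists c a b b', g = gen a (c *: b + b') - (c *: gen a b + gen a b'))
        \/ (exists a, g = gen a a)].

Definition ext_square := quot_span ext_relators.

HB.instance Definition _ := GRing.Lmodule.on ext_square.

Definition wedge (a b : T) : ext_square := quot_class ext_relators (gen a b).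

End ExteriorSquare.

Arguments ext_relators {k} T _.
Arguments wedge {k T} a b.

(* Meaningful when [f] is bilinear and alternating: it is then the linear map *)
(* induced by [f] (see [ext_lift_linear] and [ext_lift_wedge]).               *)
HB.lock Definition ext_lift (k : comPzRingType) (T : lmodType k)
    (M : lmodType k) (f : T -> T -> M) (x : ext_square T) : M :=
  free_lift (fun p => f p.1 p.2) (quot_repr x).

Section ExteriorSquareTheory.
Variables (k : comPzRingType) (T : lmodType k).

Definition alternating (M : lmodType k) (f : T -> T -> M) : Prop :=
  [/\ forall b, linear (f^~ b), forall a, linear (f a) & forall a, f a a = 0].

Lemma wedge_alternating : alternating wedge.
Proof.
split=> [b c a a'|a c b b'|a]; rewrite /wedge.
- rewrite -quot_class_linear; apply/quot_class_eq/mem_span.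
  by left; exists c, a, a', b.
- rewrite -quot_class_linear; apply/quot_class_eq/mem_span.
  by right; left; exists c, a, b, b'.
- have <- : quot_class (ext_relators T) 0 = 0 by exact: linear0.
  by apply/quot_class_eq/mem_span; rewrite subr0; right; right; exists a.
Qed.

Lemma ext_ind (P : ext_square T -> Prop) :
  P 0 -> (forall c x y, P x -> P y -> P (c *: x + y)) ->
  (forall a b, P (wedge a b)) -> forall x, P x.
Proof.
move=> P0 Plin Pw x; rewrite -[x]quot_reprK.
elim/free_gen_ind: (quot_repr x) => [|c g h Pg Ph|[a b]]; last exact: Pw.
  by rewrite (linear0 (@quot_class k _ (ext_relators T))).
by rewrite quot_class_linear; apply: Plin.
Qed.

Section Lift.
Variables (M : lmodType k) (f : T -> T -> M).
Hypothesis f_alt : alternating f.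

Let lift := free_lift (fun p : T * T => f p.1 p.2).

HB.instance Definition _ := GRing.isLinear.Build k _ M _ lift
  (free_lift_linear (fun p : T * T => f p.1 p.2)).

Lemma ext_lift_class g : ext_lift f (quot_class (ext_relators T) g) = lift g.
Proof.
suff H h : h \in span (ext_relators T) -> lift h = 0.
  apply/eqP; rewrite -subr_eq0 [ext_lift]unlock -[free_lift _ _]/(lift _) -linearB; apply/eqP/H.
  by apply/quot_class_eq; rewrite quot_reprK.
have [fl fr f0] := f_alt.
elim/span_ind=> [|c x y x0 y0|r]; first exact: linear0.
  by rewrite linearP /= x0 y0 scaler0 addr0.
case=> [[c [a [a' [b ->]]]]|[[c [a [b [b' ->]]]]|[a ->]]].
- by rewrite linearB linearP /= /lift !free_lift_gen /= fl subrr.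
- by rewrite linearB linearP /= /lift !free_lift_gen /= fr subrr.
- by rewrite /lift free_lift_gen /= f0.
Qed.

Lemma ext_lift_linear : linear (ext_lift f).
Proof.
move=> c x y; rewrite -[x]quot_reprK -[y]quot_reprK -quot_class_linear.
by rewrite !ext_lift_class linearP.
Qed.

Lemma ext_lift_wedge a b : ext_lift f (wedge a b) = f a b.
Proof. by rewrite ext_lift_class /lift free_lift_gen. Qed.

End Lift.

(* Meaningful when [f] is linear (see [ext_act_linear] and [ext_act_wedge]). *)
Definition ext_act (f : T -> T) : ext_square T -> ext_square T :=
  ext_lift (fun c d => wedge (f c) d + wedge c (f d)).

Section ActLinear.
Variable f : T -> T.
Hypothesis f_linear : linear f.

Lemma ext_act_alt : alternating (fun c d => wedge (f c) d + wedge c (f d)).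
Proof.
have [wl wr w0] := wedge_alternating.
split=> [b c a a'|a c b b'|a].
- by rewrite f_linear !wl scalerDr addrACA.
- by rewrite f_linear !wr scalerDr addrACA.
- have := w0 (1 *: f a + a).
  rewrite wl (wr (f a)) (wr a) (w0 a) (w0 (f a)).
  by rewrite scaler0 add0r addr0 !scale1r.
Qed.

Lemma ext_act_linear : linear (ext_act f).
Proof. exact/ext_lift_linear/ext_act_alt. Qed.

Lemma ext_act_wedge c d : ext_act f (wedge c d) = wedge (f c) d + wedge c (f d).
Proof. exact/ext_lift_wedge/ext_act_alt. Qed.

End ActLinear.

End ExteriorSquareTheory.

Lemma comb_swap (k : comPzRingType) (V : lmodType k) (c d : k) (x y u v : V) :
  d *: (c *: x + u) + (c *: y + v) = c *: (d *: x + y) + (d *: u + v).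
Proof. by rewrite !scalerDr !scalerA [c * d]mulrC addrACA. Qed.

Lemma comb_subr (k : pzRingType) (V : lmodType k) (d : k) (x y u v : V) :
  d *: x + u - (d *: y + v) = d *: (x - y) + (u - v).
Proof. by rewrite scalerBr opprD addrACA. Qed.

Lemma comb_comm (V : zmodType) (x1 x2 y1 y2 m n : V) :
  x1 - y1 + (x2 - y2) = x1 + m + (n + x2) - (y1 + n + (m + y2)).
Proof.
rewrite !opprD !addrA [RHS](ACl (1*5*4*8*(2*7)*(3*6))).
by rewrite /= !subrr !addr0.
Qed.

Lemma comb_polar (k : pzRingType) (V : lmodType k) (p q r s : V) :
  r + q = (-1) *: s + ((-1) *: p + (p + q + (r + s))).
Proof.
by rewrite !scaleN1r !addrA [RHS](ACl (5*4*(1*6)*(2*3)))/= !addNr !addr0.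
Qed.

Section UnbundledLinear.
Variables (k : pzRingType) (U V : lmodType k) (f : U -> V).
Hypothesis lf : linear f.

Lemma lin0 : f 0 = 0.
Proof. by have := lf (-1) 0 0; rewrite scaler0 addr0 scaleN1r addNr. Qed.
Lemma linD u v : f (u + v) = f u + f v.
Proof. by have := lf 1 u v; rewrite !scale1r. Qed.
Lemma linB u v : f (u - v) = f u - f v.
Proof. by rewrite addrC -scaleN1r lf scaleN1r addrC. Qed.

End UnbundledLinear.

Section AngleModule.
Variables (k : comPzRingType) (T : lieTripleType k).

Definition inner_der (a b : T) : T -> T := fun c => triple a b c.

(* The linear map to End_k(T), here as a map to the module of all functions   *)
(* T -> T; its values are linear by [ext_lambda_endo].                        *)
Definition ext_lambda : ext_square T -> (T -> T) := ext_lift inner_der.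

Definition angle_relators : set (ext_square T) :=
  [set y | exists x, y = ext_act (ext_lambda x) x].

Definition angle := quot_span angle_relators.

HB.instance Definition _ := GRing.Lmodule.on angle.

Definition ang (a b : T) : angle := quot_class angle_relators (wedge a b).

(* [mu] and [angle_lie] are defined on representatives; [mu_class] and        *)
(* [angle_lie_class] show that they do not depend on the choice.              *)
Definition mu (X : angle) : T -> T := ext_lambda (quot_repr X).

Definition angle_lie (X Y : angle) : angle :=
  quot_class angle_relators (ext_act (mu X) (quot_repr Y)).

Lemma inner_der_alt : alternating inner_der.
Proof.
split=> [b c a a'|a c b b'|a]; apply/funext => d; rewrite /inner_der.
- exact: triple_linear1.
- exact: triple_linear2.
- exact: triple_alt.
Qed.

Lemma ext_lambda_linear : linear ext_lambda.
Proof. exact/ext_lift_linear/inner_der_alt. Qed.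

Lemma ext_lambda_wedge a b : ext_lambda (wedge a b) = inner_der a b.
Proof. exact/ext_lift_wedge/inner_der_alt. Qed.

Lemma ext_lambda_endo x : linear (ext_lambda x).
Proof.
elim/(@ext_ind k T): x => [|c x y lx ly|a b].
- by rewrite (lin0 ext_lambda_linear) => d u v; rewrite scaler0 addr0.
- rewrite ext_lambda_linear => d u v /=.
  rewrite -![(c *: _ + _) _]/(c *: ext_lambda x _ + ext_lambda y _).
  by rewrite lx ly; exact: esym (comb_swap _ _ _ _ _ _).
- by rewrite ext_lambda_wedge; exact: triple_linear3.
Qed.

Lemma ext_lambda_der x c d e :
  ext_lambda x (triple c d e) =
    triple (ext_lambda x c) d e + triple c (ext_lambda x d) e
    + triple c d (ext_lambda x e).
Proof.
have t1 d' e' : linear (fun c' : T => triple c' d' e') := triple_linear1 d' e'.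
have t2 c' e' : linear (fun d' : T => triple c' d' e') := triple_linear2 c' e'.
have t3 c' d' : linear (triple c' d' : T -> T) := triple_linear3 c' d'.
elim/(@ext_ind k T): x => [|r x y dx dy|a b]; last first.
- by rewrite ext_lambda_wedge; exact: triple_der.
- rewrite ext_lambda_linear.
  rewrite -![(r *: _ + _) _]/(r *: ext_lambda x _ + ext_lambda y _).
  rewrite dx dy t3 t2 t1 !scalerDr !addrA.
  by rewrite (ACl (1*4*2*5*3*6)).
rewrite (lin0 ext_lambda_linear) -![(0 : T -> T) _]/(0 : T).
by rewrite (lin0 (t1 d e)) (lin0 (t2 c e)) (lin0 (t3 c d)) !addr0.
Qed.

Lemma ext_act_linearl c f g x : linear f -> linear g ->
  ext_act (c *: f + g) x = c *: ext_act f x + ext_act g x :> ext_square T.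
Proof.
move=> lf lg; have lfg : linear (c *: f + g).
  move=> d u v; rewrite -![(c *: f + g) _]/(c *: f _ + g _).
  by rewrite lf lg; exact: esym (comb_swap _ _ _ _ _ _).
have [wl wr _] := @wedge_alternating k T.
elim/(@ext_ind k T): x => [|d x y ex ey|a b].
- rewrite (lin0 (ext_act_linear lfg)) (lin0 (ext_act_linear lf)).
  by rewrite (lin0 (ext_act_linear lg)) scaler0 addr0.
- rewrite (ext_act_linear lfg) (ext_act_linear lf) (ext_act_linear lg) ex ey.
  exact: comb_swap.
- rewrite !ext_act_wedge // -![(c *: f + g) _]/(c *: f _ + g _).
  by rewrite wl wr scalerDr addrACA.
Qed.

Lemma ext_act_comm f g x : linear f -> linear g ->
  ext_act (fun a => f (g a) - g (f a)) x =
    ext_act f (ext_act g x) - ext_act g (ext_act f x) :> ext_square T.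
Proof.
move=> lf lg; pose h a := f (g a) - g (f a).
have lh : linear h.
  by move=> d u v; rewrite /h lf lg lf lg comb_subr.
have af := ext_act_linear lf; have ag := ext_act_linear lg.
have ah := ext_act_linear lh.
have [wl wr _] := @wedge_alternating k T.
rewrite -/h; elim/(@ext_ind k T): x => [|d x y ex ey|a b].
- by rewrite (lin0 ah) (lin0 af) (lin0 ag) (lin0 af) subrr.
- by rewrite af ag ah ex ey af ag comb_subr.
- rewrite !ext_act_wedge // (linD af) (linD ag) !ext_act_wedge // /h.
  rewrite (linB (wl b)) (linB (wr a)); exact: comb_comm.
Qed.

Lemma ext_lambda_act x y :
  ext_lambda (ext_act (ext_lambda x) y) =
  (fun a => ext_lambda x (ext_lambda y a) - ext_lambda y (ext_lambda x a)).
Proof.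
have lx := ext_lambda_endo x; apply/funext => c.
elim/(@ext_ind k T): y => [|r y z ey ez|a b].
- rewrite (lin0 (ext_act_linear lx)) (lin0 ext_lambda_linear) -![(0 : T -> T) _]/(0 : T).
  by rewrite (lin0 lx) subrr.
- rewrite ext_act_linear // !ext_lambda_linear.
  rewrite -![(r *: _ + _) _]/(r *: ext_lambda _ _ + ext_lambda _ _).
  by rewrite ey ez lx comb_subr.
- rewrite ext_act_wedge // (linD ext_lambda_linear) !ext_lambda_wedge /inner_der.
  rewrite -[LHS]/(triple (ext_lambda x a) b c + triple a (ext_lambda x b) c).
  by rewrite ext_lambda_der addrK.
Qed.

Lemma ext_lambda_relators y : y \in span angle_relators -> ext_lambda y = 0.
Proof.
elim/span_ind=> [|c u v u0 v0|_ [x ->]]; first exact: lin0 ext_lambda_linear.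
  by rewrite ext_lambda_linear u0 v0 scaler0 addr0.
by rewrite ext_lambda_act; apply/funext => a; rewrite subrr.
Qed.

Lemma ext_act_relators z y : y \in span angle_relators ->
  ext_act (ext_lambda z) y \in span angle_relators.
Proof.
have lz := ext_lambda_endo z.
have actD u : linear (@ext_act k T (ext_lambda u)).
  exact/ext_act_linear/ext_lambda_endo.
elim/span_ind=> [|c u v Au Av|_ [x ->]].
- by rewrite (lin0 (actD z)) rpred0.
- by rewrite actD; exact: (span_submod angle_relators).2 c _ _ Au Av.
have lx := ext_lambda_endo x.
pose w := ext_act (ext_lambda z) x.
have actl u v t : ext_act (ext_lambda (u + v)) t =
    ext_act (ext_lambda u) t + ext_act (ext_lambda v) t.
  have := ext_act_linearl 1 t (ext_lambda_endo u) (ext_lambda_endo v).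
  by rewrite (linD ext_lambda_linear) !scale1r.
have Aact u : ext_act (ext_lambda u) u \in span angle_relators.
  by apply: mem_span; exists u.
have -> : ext_act (ext_lambda z) (ext_act (ext_lambda x) x) =
    ext_act (ext_lambda w) x + ext_act (ext_lambda x) w.
  rewrite [in RHS]/w ext_lambda_act (ext_act_comm x lz lx).
  exact: esym (subrK _ _).
have -> : ext_act (ext_lambda w) x + ext_act (ext_lambda x) w =
    (-1) *: ext_act (ext_lambda w) w + ((-1) *: ext_act (ext_lambda x) x
      + ext_act (ext_lambda (x + w)) (x + w)).
  by rewrite actl !(linD (actD _)); exact: comb_polar.
apply: (span_submod angle_relators).2 => //.
by apply: (span_submod angle_relators).2.
Qed.

Lemma mu_class x : mu (quot_class _ x) = ext_lambda x.
Proof.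
apply/eqP; rewrite -subr_eq0 /mu -(linB ext_lambda_linear); apply/eqP/ext_lambda_relators.
by apply/quot_class_eq; rewrite quot_reprK.
Qed.

Lemma mu_linear : linear mu.
Proof.
move=> c X Y; rewrite -[X]quot_reprK -[Y]quot_reprK -(quot_class_linear angle_relators).
by rewrite !mu_class ext_lambda_linear.
Qed.

Lemma mu_endo X : linear (mu X). Proof. exact: ext_lambda_endo. Qed.

Lemma mu_ang a b c : mu (ang a b) c = triple a b c.
Proof. by rewrite mu_class ext_lambda_wedge. Qed.

Lemma ang_alternating : alternating ang.
Proof.
have [wl wr w0] := @wedge_alternating k T.
by split=> [b c a a'|a c b b'|a];
  rewrite /ang ?wl ?wr ?w0 ?quot_class_linear // linear0.
Qed.

Lemma angle_ind (P : angle -> Prop) :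
  P 0 -> (forall c x y, P x -> P y -> P (c *: x + y)) ->
  (forall a b, P (ang a b)) -> forall x, P x.
Proof.
move=> P0 Plin Pw X; rewrite -[X]quot_reprK.
elim/(@ext_ind k T): (quot_repr X) => [|c g h Pg Ph|a b]; last exact: Pw.
  by rewrite linear0.
by rewrite quot_class_linear; apply: Plin.
Qed.

Lemma angle_lie_class X y :
  angle_lie X (quot_class _ y) = quot_class _ (ext_act (mu X) y).
Proof.
apply/quot_class_eq; rewrite -(linB (ext_act_linear (mu_endo X))); apply: ext_act_relators.
by apply/quot_class_eq; rewrite quot_reprK.
Qed.

Lemma angle_lie_angr X c d : angle_lie X (ang c d) = ang (mu X c) d + ang c (mu X d).
Proof. by rewrite angle_lie_class ext_act_wedge ?linearD //; exact: mu_endo. Qed.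

Lemma angle_lie_ang a b c d :
  angle_lie (ang a b) (ang c d) = ang (triple a b c) d + ang c (triple a b d).
Proof. by rewrite angle_lie_angr !mu_ang. Qed.

Lemma angle_lie_linearl Y : linear (angle_lie^~ Y).
Proof.
move=> c X X'; rewrite /angle_lie mu_linear ext_act_linearl ?quot_class_linear //;
  exact: mu_endo.
Qed.

Lemma angle_lie_linearr X : linear (angle_lie X).
Proof.
move=> c Y Y'; rewrite -[Y]quot_reprK -[Y']quot_reprK -(quot_class_linear angle_relators).
by rewrite !angle_lie_class ext_act_linear ?quot_class_linear //; exact: mu_endo.
Qed.

Lemma angle_liexx X : angle_lie X X = 0.
Proof.
rewrite -(lin0 (quot_class_linear angle_relators)).
by apply/quot_class_eq; rewrite subr0; apply: mem_span; exists (quot_repr X).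
Qed.

Lemma angle_lieC X Y : angle_lie X Y = - angle_lie Y X.
Proof.
have := angle_liexx (1 *: X + Y).
rewrite angle_lie_linearl !angle_lie_linearr !angle_liexx !scale1r.
by rewrite add0r addr0 => /eqP; rewrite addr_eq0 => /eqP.
Qed.

Lemma mu_lie X Y a : mu (angle_lie X Y) a = mu X (mu Y a) - mu Y (mu X a).
Proof. by rewrite /angle_lie mu_class /mu ext_lambda_act. Qed.

Lemma angle_lie_lie X Y Z : angle_lie (angle_lie X Y) Z =
  angle_lie X (angle_lie Y Z) - angle_lie Y (angle_lie X Z).
Proof.
rewrite -[Z]quot_reprK !angle_lie_class -linearB; congr quot_class.
rewrite -ext_act_comm; [|exact: mu_endo..].
by congr ext_act; apply/funext => a; rewrite mu_lie.
Qed.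

Lemma angle_lie_jacobi X Y Z :
  angle_lie X (angle_lie Y Z) + angle_lie Y (angle_lie Z X)
  + angle_lie Z (angle_lie X Y) = 0.
Proof.
rewrite [angle_lie Z (angle_lie X Y)]angle_lieC angle_lie_lie opprB.
rewrite [angle_lie Z X]angle_lieC.
have lY := angle_lie_linearr Y.
by rewrite -[- angle_lie X Z]sub0r (linB lY) (lin0 lY) sub0r addrA subrK subrr.
Qed.

HB.instance Definition _ := isLieAlgebra.Build k angle
  angle_lie_linearl angle_lie_linearr angle_liexx angle_lie_jacobi.

End AngleModule.

Definition frakA (k : comPzRingType) (T : lieTripleType k) : Type :=
  (angle T * T)%type.

Section FrakA.
Variables (k : comPzRingType) (T : lieTripleType k).

HB.instance Definition _ := GRing.Lmodule.on (frakA T).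

Definition frakA_lie (x y : frakA T) : frakA T :=
  (lie x.1 y.1 + ang x.2 y.2, mu x.1 y.2 - mu y.1 x.2).

Definition frakA_grade (i : 'Z_2) : {pred frakA T} :=
  fun x => if i == 0 then x.2 == 0 else x.1 == 0.

Lemma frakA_lie_linearl y : linear (frakA_lie^~ y).
Proof.
have [al _ _] := ang_alternating T.
move=> c x x'; rewrite /frakA_lie; congr pair => /=.
  by rewrite lie_linearl al scalerDr addrACA.
rewrite mu_linear -[(_ *: _ + _) _]/(c *: mu x.1 _ + mu x'.1 _).
by rewrite mu_endo scalerBr opprD addrACA.
Qed.

Lemma frakA_liexx x : frakA_lie x x = 0.
Proof.
by have [_ _ a0] := ang_alternating T; rewrite /frakA_lie liexx a0 addr0 subrr.
Qed.

Lemma angC (a b : T) : ang a b = - ang b a.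
Proof.
have [al ar a0] := ang_alternating T.
have := a0 (1 *: a + b); rewrite al !ar !a0 !scale1r.
by rewrite add0r addr0 => /eqP; rewrite addr_eq0 => /eqP.
Qed.

Lemma frakA_lieC x y : frakA_lie x y = - frakA_lie y x.
Proof.
have lC : lie x.1 y.1 = - lie y.1 x.1 := angle_lieC _ _.
by rewrite /frakA_lie lC (angC x.2) -opprD -(opprB (mu y.1 x.2)).
Qed.

Lemma frakA_lie_linearr x : linear (frakA_lie x).
Proof.
move=> c y y'; rewrite frakA_lieC frakA_lie_linearl opprD -scalerN.
by rewrite -!frakA_lieC.
Qed.

Lemma frakA_lie_jacobi x y z :
  frakA_lie x (frakA_lie y z) + frakA_lie y (frakA_lie z x)
  + frakA_lie z (frakA_lie x y) = 0.
Proof.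
case: x y z => [X a] [Y b] [Z c]; rewrite /frakA_lie /=.
have lieD (U V W : angle T) : lie U (V + W) = lie U V + lie U W.
  exact: linD (lie_linearr U) V W.
have [_ ar _] := ang_alternating T.
have angB u v w : ang u (v - w) = ang u v - ang u w :> angle T.
  exact: linB (ar u) v w.
have muB U v w : mu U (v - w) = mu U v - mu U w :> T.
  exact: linB (mu_endo U) v w.
congr pair => /=.
  have lieE U u v : lie U (ang u v) = ang (mu U u) v + ang u (mu U v) :> angle T.
    exact: angle_lie_angr.
  rewrite !lieD !angB !lieE !addrA.
  rewrite (ACl ((1*6*11)*(2*14)*(3*10)*(4*7)*(5*13)*(8*15)*(9*12)))/=.
  rewrite lie_jacobi (angC (mu X b)) (angC a (mu Y c)) (angC b (mu Z a)).
  by rewrite !addNr !subrr !addr0.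
have muE U u v w : mu (U + ang u v) w = mu U w + triple u v w :> T.
  by rewrite (linD (@mu_linear _ T)) -mu_ang.
have muL U V w : mu (lie U V) w = mu U (mu V w) - mu V (mu U w) :> T.
  exact: mu_lie.
rewrite !muE !muB !muL !opprD !opprK !addrA.
rewrite (ACl ((1*13)*(2*9)*(3*6)*(4*12)*(7*14)*(8*11)*(5*10*15)))/=.
by rewrite !addNr !subrr !add0r -!opprD triple_cyc oppr0.
Qed.

HB.instance Definition _ := isLieAlgebra.Build k (frakA T)
  frakA_lie_linearl frakA_lie_linearr frakA_liexx frakA_lie_jacobi.

Lemma frakA_grade_submod i : submod_closed (frakA_grade i).
Proof.
by rewrite /frakA_grade; case: eqP => _; split;
  rewrite ?unfold_in /= ?eqxx // => c x y /eqP + /eqP; rewrite !unfold_in /=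
  => -> ->; rewrite scaler0 addr0.
Qed.

Lemma frakA_grade_span x : exists2 x0, x0 \in frakA_grade 0 &
  exists2 x1, x1 \in frakA_grade 1 & x = x0 + x1.
Proof.
case: x => X a; exists ((X, 0) : frakA T); rewrite ?unfold_in //=.
exists ((0, a) : frakA T); rewrite ?unfold_in //=.
by congr pair; rewrite /= ?addr0 ?add0r.
Qed.

Lemma frakA_grade_indep x :
  x \in frakA_grade 0 -> x \in frakA_grade 1 -> x = 0.
Proof. by case: x => X a; rewrite !unfold_in /= => /eqP -> /eqP ->. Qed.

Lemma frakA_grade_lie i j x y :
  x \in frakA_grade i -> y \in frakA_grade j ->
  frakA_lie x y \in frakA_grade (i + j).
Proof.
have [al ar _] := ang_alternating T.
have mu0 (U : angle T) : mu U 0 = 0 :> T := lin0 (mu_endo U).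
have a0l b : ang 0 b = 0 :> angle T := lin0 (al b).
have a0r b : ang b 0 = 0 :> angle T := lin0 (ar b).
have l0l (U : angle T) : lie 0 U = 0 := lin0 (lie_linearl U).
have l0r (U : angle T) : lie U 0 = 0 := lin0 (lie_linearr U).
have m0 b : mu 0 b = 0 :> T by rewrite (lin0 (@mu_linear _ T)).
have Z2P (n : 'Z_2) : n = 0 \/ n = 1.
  by case: n => [[|[|//]] ?]; [left|right]; apply/val_inj.
have Z2_11 : 1 + 1 = 0 :> 'Z_2 by apply/val_inj.
case: x y => [X a] [Y b].
case: (Z2P i) => ->; case: (Z2P j) => ->; rewrite ?Z2_11 ?addr0 ?add0r;
  rewrite !unfold_in => /eqP /= -> /eqP /= ->; apply/eqP.
- by rewrite mu0 mu0 subrr.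
- by rewrite l0r a0l addr0.
- by rewrite l0l a0r addr0.
- by rewrite m0 m0 subrr.
Qed.

HB.instance Definition _ := isZ2Graded.Build k (frakA T)
  frakA_grade_submod frakA_grade_span frakA_grade_indep frakA_grade_lie.

End FrakA.

(* Main.v *)
Require Import Defs.
From HB Require Import structures.
From mathcomp Require Import all_boot all_algebra.
From mathcomp Require Import boolp functions.

(* Everything rests on a universal property of A(T): a linear map s from T to *)
(* the odd part of K with s [a, b, c] = [[s a, s b], s c] extends to a graded *)
(* homomorphism A(T) -> K.                                                    *)
(*   Since the kernel of a central 0-extension of A(T) is even, odd elements  *)
(* have unique odd lifts; these form such an s on T, and its extension splits *)
(* the central 0-extension, because A(T) is generated by T.                   *)
(*   Conversely, for T = L_1 the inclusion extends to A(L_1) -> L, which is   *)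
(* onto when L_1 generates L. An element of its kernel is some X in <T, T>    *)
(* with mu X = 0, and such an X is central. A splitting of this central       *)
(* 0-extension restricts to the identity on T, hence is its inverse.          *)

Set Implicit Arguments.
Unset Strict Implicit.
Unset Printing Implicit Defensive.

Import GRing.Theory.
Local Open Scope ring_scope.

(** * Elementary identities in a Lie algebra *)

Section LieAlgebraTheory.
Variables (k : comPzRingType) (L : lieAlgType k).
Implicit Types x y z : L.

Lemma lie0l x : lie 0 x = 0. Proof. exact: lin0 (lie_linearl x). Qed.

Lemma lie0r x : lie x 0 = 0. Proof. exact: lin0 (lie_linearr x). Qed.

Lemma lieDl x y z : lie (x + y) z = lie x z + lie y z.
Proof. exact: linD (lie_linearl z) x y. Qed.

Lemma lieDr x y z : lie x (y + z) = lie x y + lie x z.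
Proof. exact: linD (lie_linearr x) y z. Qed.

Lemma lieC x y : lie x y = - lie y x.
Proof.
have := liexx (x + y); rewrite lieDl !lieDr !liexx add0r addr0.
by move/eqP; rewrite addr_eq0 => /eqP.
Qed.

Lemma lieNr x y : lie x (- y) = - lie x y.
Proof. by rewrite -[in LHS](sub0r y) (linB (lie_linearr x)) lie0r sub0r. Qed.

(** The Jacobi identity in the form used throughout: ad x is a derivation. *)
Lemma lie_der x y z : lie x (lie y z) = lie (lie x y) z + lie y (lie x z).
Proof.
have /eqP := lie_jacobi x y z; rewrite (lieC z x) lieNr (lieC z (lie x y)).
by rewrite -addrA -opprD subr_eq0 addrC => /eqP.
Qed.

End LieAlgebraTheory.

(** * Graded homomorphisms and homogeneous components *)

Section GradedHomTheory.
Variables (k : comPzRingType) (K L : gradedLieAlgType k).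

Lemma graded_hom_comp (M : gradedLieAlgType k) (f : L -> M) (g : K -> L) :
  graded_hom f -> graded_hom g -> graded_hom (f \o g).
Proof.
case=> fl fm fg [gl gm gg]; split=> [c x y|x y|i x xi] /=.
- by rewrite gl fl.
- by rewrite gm fm.
- exact/fg/gg.
Qed.

Lemma graded_hom_id : graded_hom (@id L).
Proof. by []. Qed.

(** The set where two homomorphisms agree is a subalgebra; once it contains the odd part, it is
    everything. *)
Lemma graded_hom_eq (f g : K -> L) : generated_by_odd K ->
  graded_hom f -> graded_hom g -> {in grade 1, f =1 g} -> f =1 g.
Proof.
move=> gen [fl fm _] [gl gm _] fg x.
apply/asboolP; apply: (gen (fun x => `[< f x = g x >])); last first.
  by move=> y y1; apply/asboolP/fg.
split; first split.
- by apply/asboolP; rewrite (lin0 fl) (lin0 gl).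
- by move=> c y z /asboolP fgy /asboolP fgz; apply/asboolP; rewrite fl gl fgy fgz.
- by move=> y z /asboolP fgy /asboolP fgz; apply/asboolP; rewrite fm gm fgy fgz.
Qed.

Lemma grade0 i : 0 \in @grade k L i.
Proof. exact: (grade_submod i).1. Qed.

Lemma gradeP i c (x y : L) : x \in grade i -> y \in grade i ->
  c *: x + y \in grade i.
Proof. exact: (grade_submod i).2. Qed.

Lemma gradeB i (x y : L) : x \in grade i -> y \in grade i -> x - y \in grade i.
Proof. by move=> xi yi; rewrite addrC -scaleN1r gradeP. Qed.

Lemma odd_lie_lie (x y z : L) :
  x \in grade 1 -> y \in grade 1 -> z \in grade 1 -> lie (lie x y) z \in grade 1.
Proof.
move=> x1 y1 z1; have -> : 1 = 1 + 1 + 1 :> 'Z_2 by apply/val_inj.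
by do 2?apply: grade_lie.
Qed.

End GradedHomTheory.

Lemma Z2_case (i : 'Z_2) : i = 0 \/ i = 1.
Proof. by case: i => [[|[|//]] ?]; [left|right]; apply/val_inj. Qed.

(** * The universal property of A(T) *)

Section UniversalProperty.
Variables (k : comPzRingType) (T : lieTripleType k) (K : gradedLieAlgType k).
Variable s : T -> K.
Hypotheses (s_linear : linear s) (s_odd : forall a, s a \in grade 1).
Hypothesis s_triple : forall a b c, s (triple a b c) = lie (lie (s a) (s b)) (s c).

Lemma lie_alternating : alternating (fun a b => lie (s a) (s b)).
Proof.
split=> [b c a a'|a c b b'|a]; rewrite ?s_linear; last exact: liexx.
- exact: lie_linearl.
- exact: lie_linearr.
Qed.

Definition ext_bracket : ext_square T -> K :=
  ext_lift (fun a b => lie (s a) (s b)).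

Lemma ext_bracket_linear : linear ext_bracket.
Proof. exact/ext_lift_linear/lie_alternating. Qed.

Lemma ext_bracket_wedge a b : ext_bracket (wedge a b) = lie (s a) (s b).
Proof. by rewrite /ext_bracket ext_lift_wedge //; exact: lie_alternating. Qed.

(** This is [s_triple] extended linearly from wedges: [s] carries the action of [ext_lambda x] to ad
    of [ext_bracket x]. *)
Lemma lift_ext_lambda x c : s (ext_lambda x c) = lie (ext_bracket x) (s c).
Proof.
elim/(@ext_ind k T): x => [|r x y ex ey|a b].
- by rewrite (lin0 (@ext_lambda_linear k T)) (lin0 ext_bracket_linear) lie0l;
    exact: lin0 s_linear.
- rewrite ext_lambda_linear -![(_ *: _ + _) c]/(r *: ext_lambda x c + ext_lambda y c).
  by rewrite s_linear ex ey ext_bracket_linear lie_linearl.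
- by rewrite ext_lambda_wedge ext_bracket_wedge; exact: s_triple.
Qed.

(** On a wedge y, [lift_ext_lambda] turns the left side into the Leibniz expansion of ad
    ([ext_bracket x]). The case y = x shows that the relators of <T, T> are killed. *)
Lemma ext_bracket_act x y :
  ext_bracket (ext_act (ext_lambda x) y) = lie (ext_bracket x) (ext_bracket y).
Proof.
have al := ext_act_linear (ext_lambda_endo x).
elim/(@ext_ind k T): y => [|r y z ey ez|c d].
- by rewrite (lin0 al) (lin0 ext_bracket_linear) lie0r.
- by rewrite al !ext_bracket_linear ey ez lie_linearr.
- rewrite ext_act_wedge; last exact: ext_lambda_endo.
  rewrite (linD ext_bracket_linear) !ext_bracket_wedge !lift_ext_lambda.
  by rewrite [RHS]lie_der.
Qed.

Definition angle_lift (X : angle T) : K := ext_bracket (quot_repr X).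

(** Independence of the representative: a relator, the action of [ext_lambda y] on y, goes to the
    bracket of [ext_bracket y] with itself, which is 0. *)
Lemma angle_lift_class x : angle_lift (quot_class _ x) = ext_bracket x.
Proof.
apply/eqP; rewrite -subr_eq0 /angle_lift -(linB ext_bracket_linear).
have : quot_repr (quot_class (@angle_relators k T) x) - x \in Defs.span (@angle_relators k T).
  by apply/quot_class_eq; rewrite quot_reprK.
elim/span_ind=> [|c y z /eqP y0 /eqP z0|_ [y ->]].
- by rewrite (lin0 ext_bracket_linear).
- by rewrite ext_bracket_linear y0 z0 scaler0 addr0.
- by rewrite ext_bracket_act liexx.
Qed.

Lemma angle_lift_linear : linear angle_lift.
Proof.
move=> c X Y; rewrite -[X]quot_reprK -[Y]quot_reprK.
by rewrite -(quot_class_linear (@angle_relators k T)) !angle_lift_class ext_bracket_linear.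
Qed.

Lemma angle_lift_ang a b : angle_lift (ang a b) = lie (s a) (s b).
Proof. by rewrite angle_lift_class ext_bracket_wedge. Qed.

Lemma lift_mu X c : s (mu X c) = lie (angle_lift X) (s c).
Proof. exact: lift_ext_lambda. Qed.

Lemma angle_lift_lie (X Y : angle T) :
  angle_lift (lie X Y) = lie (angle_lift X) (angle_lift Y).
Proof. by rewrite [LHS]angle_lift_class ext_bracket_act. Qed.

Lemma angle_lift_even X : angle_lift X \in grade 0.
Proof.
elim/(@angle_ind k T): X => [|c X Y X0 Y0|a b].
- by rewrite (lin0 angle_lift_linear) grade0.
- by rewrite angle_lift_linear gradeP.
- rewrite angle_lift_ang; have -> : 0 = 1 + 1 :> 'Z_2 by apply/val_inj.
  exact: grade_lie.
Qed.

Definition frakA_lift (x : frakA T) : K := angle_lift x.1 + s x.2.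

(** The bracket splits by parity: even-even is [angle_lift_lie], odd-odd is [angle_lift_ang], and
    the two mixed terms are [lift_mu]. *)
Lemma frakA_lift_hom : graded_hom frakA_lift.
Proof.
have AD := linD angle_lift_linear; have sB := linB s_linear.
split=> [c x y|x y|i [X a]].
- by rewrite /frakA_lift angle_lift_linear s_linear scalerDr addrACA.
- rewrite {1}/frakA_lift AD sB !lift_mu angle_lift_lie angle_lift_ang.
  rewrite lieDl !lieDr (lieC (s x.2) (angle_lift y.1)) -!addrA; congr (_ + _).
  by rewrite [LHS]addrC -addrA.
- case: (Z2_case i) => ->; rewrite unfold_in => /eqP /= ->; rewrite /frakA_lift.
  + by rewrite (lin0 s_linear) addr0 angle_lift_even.
  + by rewrite (lin0 angle_lift_linear) add0r s_odd.
Qed.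

Lemma frakA_lift_odd a : frakA_lift ((0, a) : frakA T) = s a.
Proof. by rewrite /frakA_lift (lin0 angle_lift_linear) add0r. Qed.

End UniversalProperty.

(** * A(T) is generated by T and is 0-centrally closed *)

Section FrakATheory.
Variables (k : comPzRingType) (T : lieTripleType k).

Definition frakA_odd (a : T) : frakA T := (0, a).

Lemma frakA_odd_linear : linear frakA_odd.
Proof. by move=> c a b; congr pair; rewrite /= scaler0 addr0. Qed.

Lemma frakA_odd_grade a : frakA_odd a \in grade 1.
Proof. by rewrite unfold_in /=. Qed.

Lemma frakA_grade1 x : x \in @grade k (frakA T) 1 -> x = frakA_odd x.2.
Proof. by case: x => X a; rewrite unfold_in => /eqP /= ->. Qed.

(** X enters the product of <T, T> only through [mu X]; hence elements killed by [mu] are central in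
    A(T). *)
Lemma angle_lie_mu0 (X Y : angle T) : mu X = 0 -> lie X Y = 0.
Proof.
move=> X0; rewrite -(lie0l Y) -[LHS]/(angle_lie X Y) -[RHS]/(angle_lie 0 Y).
by rewrite /angle_lie X0 (lin0 (@mu_linear k T)).
Qed.

Lemma frakA_lie_odd a b : lie (frakA_odd a) (frakA_odd b) = (ang a b, 0) :> frakA T.
Proof.
rewrite -[LHS]/(frakA_lie _ _) /frakA_lie /= (lie0l (0 : angle T)) add0r.
by rewrite (lin0 (@mu_linear k T)) subrr.
Qed.

Lemma frakA_lie_triple a b c :
  lie (lie (frakA_odd a) (frakA_odd b)) (frakA_odd c) = frakA_odd (triple a b c).
Proof.
have [al _ _] := ang_alternating T.
rewrite frakA_lie_odd -[LHS]/(frakA_lie _ _) /frakA_lie /= mu_ang.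
rewrite (lie0r (ang a b)) (lin0 (al c)) add0r.
by rewrite (lin0 (@mu_linear k T)) subr0.
Qed.

(** The even part is spanned by the elements <a, b>, and <a, b> is the bracket of the odd elements a
    and b. *)
Lemma frakA_generated : generated_by_odd (frakA T).
Proof.
move=> S [[S0 Slin] Slie] Sodd.
have S1 a : frakA_odd a \in S by apply/Sodd/frakA_odd_grade.
case=> X a.
have -> : (X, a) = 1 *: ((X, 0) : frakA T) + frakA_odd a.
  by rewrite scale1r; congr pair; rewrite /= ?addr0 ?add0r.
apply: (Slin) => //; elim/(@angle_ind k T): X => [//|c X Y SX SY|b c].
- have -> : (c *: X + Y, 0) = c *: ((X, 0) : frakA T) + (Y, 0).
    by congr pair; rewrite /= scaler0 addr0.
  exact: Slin.
- by rewrite -frakA_lie_odd; apply: Slie.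
Qed.

Lemma frakA_closed : zero_centrally_closed (frakA T).
Proof.
move=> K phi [phi_hom surj kerphi]; have [pl pm pg] := phi_hom.
(* The difference is odd, and it is even because it lies in the kernel; hence it is 0. *)
have inj1 x y : x \in grade 1 -> y \in grade 1 -> phi x = phi y -> x = y.
  move=> x1 y1 exy; apply/eqP; rewrite -subr_eq0; apply/eqP.
  apply: grade_indep; last exact: gradeB.
  by case: (kerphi (x - y)) => //; rewrite (linB pl) exy subrr.
(* The odd component of any preimage will do, since the even component maps into <T, T> and
   contributes nothing to the T-coordinate. *)
have lift a : {x | x \in grade 1 & phi x = frakA_odd a}.
  apply/cid2; have [x px] := surj (frakA_odd a).
  have [x0 x00 [x1 x11 def_x]] := grade_span x; exists x1 => //.
  have := pg _ _ x00; have /frakA_grade1 -> := pg _ _ x11.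
  move: px; rewrite def_x (linD pl); case: (phi x0) => X b; case: (phi x1) => Y c.
  by rewrite unfold_in => -[_ <-] /eqP /= ->; rewrite add0r.
pose s a := s2val (lift a).
have s_odd a : s a \in grade 1 by exact: (s2valP (lift a)).
have phis a : phi (s a) = frakA_odd a by exact: (s2valP' (lift a)).
(* By uniqueness of odd lifts, linearity and compatibility with the triple product need only be
   checked after applying [phi]. *)
have s_linear : linear s.
  by move=> c a b; apply: inj1; rewrite ?gradeP // pl !phis frakA_odd_linear.
have s_triple a b c : s (triple a b c) = lie (lie (s a) (s b)) (s c).
  apply: inj1 => //; last by rewrite !pm !phis frakA_lie_triple.
  exact: odd_lie_lie.
have psi_hom := frakA_lift_hom s_linear s_odd s_triple.
exists (frakA_lift s) => //.
apply: (graded_hom_eq frakA_generated (graded_hom_comp phi_hom psi_hom)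
  (@graded_hom_id _ _)) => x /frakA_grade1 -> /=.
by rewrite frakA_lift_odd // phis.
Qed.

End FrakATheory.

(** * The odd part of L as a Lie triple system under [[a, b], c] *)

Section OddPart.
Variables (k : comPzRingType) (L : gradedLieAlgType k).

(* A constant alias of [grade 1], to carry the closure instance. *)
Definition odd_pred : {pred L} := grade 1.

HB.instance Definition _ :=
  GRing.isSubmodClosed.Build k L odd_pred (grade_submod 1).

Definition odd_part : Type := {x : L | x \in odd_pred}.

HB.instance Definition _ := SubChoice.on odd_part.
HB.instance Definition _ := [SubChoice_isSubLmodule of odd_part by <:].

Definition odd_elt (x : L) (x1 : x \in odd_pred) : odd_part :=
  exist (fun y : L => y \in odd_pred) x x1.

Definition odd_val : odd_part -> L := val.

Lemma odd_val_inj : injective odd_val.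
Proof. exact: val_inj. Qed.

Lemma odd_val_linear : linear odd_val.
Proof. by move=> c a b; rewrite /odd_val linearP. Qed.

Fact odd_triple_subproof (a b c : odd_part) :
  lie (lie (odd_val a) (odd_val b)) (odd_val c) \in odd_pred.
Proof. exact: odd_lie_lie (valP a) (valP b) (valP c). Qed.

Definition odd_triple (a b c : odd_part) : odd_part :=
  odd_elt (odd_triple_subproof a b c).

Lemma odd_val_triple a b c :
  odd_val (odd_triple a b c) = lie (lie (odd_val a) (odd_val b)) (odd_val c).
Proof. by []. Qed.

Fact odd_triple_linear1 b c : linear (fun a => odd_triple a b c).
Proof.
move=> r a a'; apply/odd_val_inj.
by rewrite odd_val_linear !odd_val_triple odd_val_linear !lie_linearl.
Qed.

Fact odd_triple_linear2 a c : linear (fun b => odd_triple a b c).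
Proof.
move=> r b b'; apply/odd_val_inj.
by rewrite odd_val_linear !odd_val_triple odd_val_linear lie_linearr lie_linearl.
Qed.

Fact odd_triple_linear3 a b : linear (fun c => odd_triple a b c).
Proof.
move=> r c c'; apply/odd_val_inj.
by rewrite odd_val_linear !odd_val_triple odd_val_linear lie_linearr.
Qed.

Fact odd_triple_alt a b : odd_triple a a b = 0.
Proof. by apply/odd_val_inj; rewrite odd_val_triple liexx lie0l (lin0 odd_val_linear). Qed.

Fact odd_triple_cyc a b c :
  odd_triple a b c + odd_triple b c a + odd_triple c a b = 0.
Proof.
have valD := linD odd_val_linear.
apply/odd_val_inj; rewrite !valD (lin0 odd_val_linear) !odd_val_triple.
by rewrite !(lieC (lie _ _)) -!opprD lie_jacobi oppr0.
Qed.

(** ad [a, b] is a derivation of L; this is applied to [[c, d], e] and then to [c, d]. *)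
Fact odd_triple_der a b c d e :
  odd_triple a b (odd_triple c d e) =
    odd_triple (odd_triple a b c) d e + odd_triple c (odd_triple a b d) e
    + odd_triple c d (odd_triple a b e).
Proof.
have valD := linD odd_val_linear.
apply/odd_val_inj; rewrite !valD !odd_val_triple [LHS]lie_der [in LHS]lie_der.
by rewrite lieDl.
Qed.

HB.instance Definition _ := isLieTriple.Build k odd_part
  odd_triple_linear1 odd_triple_linear2 odd_triple_linear3
  odd_triple_alt odd_triple_cyc odd_triple_der.

(** * The central 0-extension from A(L_1) to L *)

Definition odd_embedding : frakA odd_part -> L := frakA_lift odd_val.

Lemma odd_val_odd (a : odd_part) : odd_val a \in grade 1.
Proof. exact: valP. Qed.

(* [odd_val_triple] with [odd_triple] hidden behind the canonical structure. *)
Lemma odd_val_triple_op (a b c : odd_part) :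
  odd_val (triple a b c) = lie (lie (odd_val a) (odd_val b)) (odd_val c).
Proof. exact: odd_val_triple. Qed.

Lemma odd_embedding_hom : graded_hom odd_embedding.
Proof. exact: frakA_lift_hom odd_val_linear odd_val_odd odd_val_triple_op. Qed.

Lemma odd_embedding_odd (a : odd_part) : odd_embedding (frakA_odd a) = odd_val a.
Proof. exact: frakA_lift_odd odd_val_linear odd_val_triple_op _. Qed.

Lemma odd_embedding_central :
  generated_by_odd L -> central_0_extension odd_embedding.
Proof.
have [fl fm _] := odd_embedding_hom => gen.
split=> [|y|[X a] fX0]; first exact: odd_embedding_hom.
(* The image is a subalgebra containing the odd part, hence all of L. *)
- apply/asboolP; apply: (gen (fun y => `[< exists x, odd_embedding x = y >])).
    split; first split.
    + by apply/asboolP; exists 0; rewrite (lin0 fl).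
    + move=> c u v /asboolP [x <-] /asboolP [x' <-]; apply/asboolP.
      by exists (c *: x + x'); rewrite fl.
    + move=> u v /asboolP [x <-] /asboolP [x' <-]; apply/asboolP.
      by exists (lie x x'); rewrite fm.
  move=> u u1; apply/asboolP; exists (frakA_odd (odd_elt u1)).
  by rewrite odd_embedding_odd.
(* The even and odd components of the image sum to 0, so each vanishes. *)
have AX0 : angle_lift odd_val X = 0.
  apply: grade_indep.
    exact: angle_lift_even odd_val_linear odd_val_odd odd_val_triple_op _.
  have -> : angle_lift odd_val X = 0 - odd_val a.
    by rewrite -fX0 /odd_embedding /frakA_lift addrK.
  by rewrite gradeB ?grade0 ?(valP a).
have a0 : a = 0.
  apply/odd_val_inj; rewrite (lin0 odd_val_linear) -fX0.
  by rewrite /odd_embedding /frakA_lift /= AX0 add0r.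
(* By [lift_mu], [mu X] acts on the odd part as ad of the image of X, which is 0. *)
have muX0 : mu X = 0.
  apply/funext => b; apply/odd_val_inj.
  by rewrite (lift_mu odd_val_linear odd_val_triple_op) AX0 lie0l (lin0 odd_val_linear).
rewrite a0; split=> [|[Y b]]; first by rewrite unfold_in.
rewrite -[LHS]/(frakA_lie _ _) /frakA_lie /=.
have [al _ _] := ang_alternating odd_part.
rewrite (lin0 (al b)) addr0 muX0 (lin0 (mu_endo Y)) subrr; congr pair.
exact: angle_lie_mu0.
Qed.

End OddPart.

(** * Invariance under graded isomorphism, and the equivalence *)

Lemma graded_iso_closed (k : comPzRingType) (L M : gradedLieAlgType k) :
  graded_iso L M -> zero_centrally_closed M -> zero_centrally_closed L.
Proof.
case=> f [g [fh gh fK gK]] clM K phi [phi_hom surj kerphi].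
have [fl _ _] := fh.
(* Composing with the injective [f] keeps the kernel, so this is a central 0-extension of M; a
   splitting of it composed with [f] splits [phi]. *)
case: (clM K (f \o phi)) => [|psi psih psiK].
  split; first exact: graded_hom_comp.
    by move=> y; have [x px] := surj (g y); exists x; rewrite /= px gK.
  by move=> x /= fx0; apply: kerphi; rewrite -[LHS]fK fx0 -(lin0 fl) fK.
exists (psi \o f); first exact: graded_hom_comp.
by move=> x; rewrite /= -[LHS]fK -[f (phi _)]/((f \o phi) _) psiK fK.
Qed.

Lemma graded_iso_generated (k : comPzRingType) (L M : gradedLieAlgType k) :
  graded_iso L M -> generated_by_odd M -> generated_by_odd L.
Proof.
case=> f [g [_ [gl gm gg] fK _]] genM S [[S0 Slin] Slie] Sodd x.
(* The preimage of S under [g] is a subalgebra of M containing its odd part. *)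
rewrite -[x]fK; apply: (genM (fun y => g y \in S)) => [|y /gg]; last exact: Sodd.
split; first split.
- by rewrite unfold_in /= (lin0 gl).
- by move=> c y z Sy Sz; rewrite unfold_in /= gl; exact: Slin.
- by move=> y z Sy Sz; rewrite unfold_in /= gm; exact: Slie.
Qed.

Theorem corollary4p7 (k : comPzRingType) (L : gradedLieAlgType k) :
  (exists T : lieTripleType k, graded_iso L (frakA T)) <->
  generated_by_odd L /\ zero_centrally_closed L.
Proof.
split=> [[T isoT]|[gen cl]].
  split; first exact: graded_iso_generated isoT (@frakA_generated k T).
  exact: graded_iso_closed isoT (@frakA_closed k T).
exists (odd_part L); have phih := odd_embedding_hom L.
have [psi psih psiK] := cl _ _ (odd_embedding_central gen).
exists psi, (@odd_embedding k L); split=> //.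
(* The splitting gives one composite. For the other, compare on odd generators: x and its image
   under the composite are both odd and have the same image in L, and the embedding is injective on
   odd elements. *)
apply: (graded_hom_eq (@frakA_generated k (odd_part L))
  (graded_hom_comp psih phih) (@graded_hom_id _ _)) => x x1 /=.
have [_ _ phig] := phih; have [_ _ psig] := psih.
have y1 := psig _ _ (phig _ _ x1); have := psiK (odd_embedding x).
move: (psi _) y1 => y y1; rewrite (frakA_grade1 x1) (frakA_grade1 y1).
by rewrite !odd_embedding_odd => /odd_val_inj ->.
Qed.
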